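(* Let $\Gamma$ be a connected divisible design graph with parameters $(v,k,\lambda_1,\lambda_2,m,n)$, where $\lambda_2=0$. Then the vertex connectivity of $\Gamma$ equals $k$.
   Context: All graphs are finite, simple and undirected. A $k$-regular graph on $v=mn$ vertices is called a divisible design graph (DDG) with parameters $(v,k,\lambda_1,\lambda_2,m,n)$ if its vertex set can be partitioned into $m$ classes of size $n$ such that two distinct vertices from the same class have exactly $\lambda_1$ common neighbours, and two vertices from different classes have exactly $\lambda_2$ common neighbours. The vertex connectivity $\varkappa(G)$ of a graph $G$ is the minimum number of vertices whose deletion from $G$ disconnects it; by convention the complete graph on $s$ vertices has vertex connectivity $s-1$. *)

(* Defs.v *)
From mathcomp Require Import all_boot.

Set Implicit Arguments.
Unset Strict Implicit.
Unset Printing Implicit Defensive.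

(* A finite simple undirected graph is a symmetric and
   irreflexive relation [e] on a finite type [V] of vertices. *)

Definition simple_graph (V : finType) (e : rel V) : Prop :=
  symmetric e /\ irreflexive e.

Definition neighbours (V : finType) (e : rel V) (x : V) : {set V} :=
  [set z | e x z].

Definition common_neighbours (V : finType) (e : rel V) (x y : V) : {set V} :=
  neighbours e x :&: neighbours e y.

Definition regular_graph (V : finType) (e : rel V) (k : nat) : Prop :=
  forall x : V, #|neighbours e x| = k.

(* When there is a single class (m = 1), or when the classes are singletons
   (n = 1), the condition on l2, respectively on l1, is vacuous; these
   degenerate cases are allowed. *)
Definition divisible_design_graph (V : finType) (e : rel V)
    (v k l1 l2 m n : nat) : Prop :=
  [/\ #|V| = v, v = (m * n)%N, regular_graph e k &
    exists P : {set {set V}},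
      [/\ partition P [set: V], #|P| = m,
          forall B, B \in P -> #|B| = n,
          forall B x y, B \in P -> x \in B -> y \in B -> x != y ->
            #|common_neighbours e x y| = l1 &
          forall B C x y, B \in P -> C \in P -> B != C -> x \in B -> y \in C ->
            #|common_neighbours e x y| = l2]].

Definition connected_graph (V : finType) (e : rel V) : Prop :=
  (0 < #|V|)%N /\ forall x y : V, connect e x y.

Definition complete_graph (V : finType) (e : rel V) : bool :=
  [forall x : V, forall y : V, (x != y) ==> e x y].

Definition delete_vertices (V : finType) (e : rel V) (S : {set V}) : rel V :=
  [rel x y | [&& x \notin S, y \notin S & e x y]].

(* Two remaining vertices must be separated, so that deleting all the vertices,
   or all but one of them, does not disconnect the graph. *)
Definition disconnects (V : finType) (e : rel V) (S : {set V}) : bool :=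
  [exists x : V, exists y : V,
    [&& x \notin S, y \notin S & ~~ connect (delete_vertices e S) x y]].

(* A graph that is not complete has a disconnecting set (the complement of a
   pair of distinct non-adjacent vertices), so the default value #|V| of the
   iterated minimum, which bounds all the #|S|, plays no role. *)
Definition vertex_connectivity (V : finType) (e : rel V) : nat :=
  if complete_graph e then #|V|.-1
  else \big[minn/#|V|]_(S : {set V} | disconnects e S) #|S|.

(* Main.v *)
(** If two neighbours of a vertex lay in different classes they would have a
    common neighbour; so, for [k >= 2], all neighbours of a class lie in a
    single class, and connectedness leaves one class (a graph in which any two
    vertices have [l1] common neighbours) or two (the incidence graph of a
    symmetric design). In both cases a non-incident pair of nonempty sets [A],
    [B] of points and blocks satisfies Haemers' bound
    [l * |A| * |B| <= (k - l) * (n - |A| - |B|)], which comes from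
    Cauchy-Schwarz and forces [n - |A| - |B| >= k - 1], with equality only if
    [A] or [B] is a singleton. For two classes, the two pairs formed by the
    parts of a cut give at least [2 * (k - 1)] cut vertices; for one class,
    fewer than [k] cut vertices would leave parts of at least two vertices, so
    that equality is excluded. The neighbourhood of a vertex is a cut of size
    [k]. *)
Require Import Defs.
From mathcomp Require Import all_boot.
From mathcomp Require Import order zify.

Set Implicit Arguments.
Unset Strict Implicit.
Unset Printing Implicit Defensive.

Import Order.TTheory.

(** * Cauchy-Schwarz and the arithmetic of Haemers' bound *)

Lemma sum_sqr_le (T : finType) (U : {set T}) (f : T -> nat) :
  (\sum_(x in U) f x) ^ 2 <= #|U| * \sum_(x in U) f x ^ 2.
Proof.
(* Doubling turns both sides into sums over pairs in [U], compared termwise by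
   [2 * (f x * f y) <= f x ^ 2 + f y ^ 2]. *)
rewrite -(leq_pmul2l (ltn0Sn 1)).
have -> : 2 * (#|U| * \sum_(x in U) f x ^ 2)
  = \sum_(x in U) \sum_(y in U) (f x ^ 2 + f y ^ 2).
  under [RHS]eq_bigr do rewrite big_split /= sum_nat_const.
  by rewrite big_split -big_distrr sum_nat_const /= mul2n addnn.
rewrite -mulnn big_distrlr big_distrr leq_sum //= => x _.
by rewrite big_distrr leq_sum //= => y _; apply: nat_Cauchy.
Qed.

(* [cs] amounts to [l a b <= (k - l) (n - a - b)], while the bounds on [a] and
   [b] give [a b >= s (n - k)] for [s = a + b + k - n], and [knl] says that
   [l (n - k) = (k - 1) (k - l)]; together they force [s <= 1]. *)
Lemma haemers_arith (n k l a b : nat) :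
  0 < a -> 0 < b -> k + a <= n -> k + b <= n -> 1 < k ->
  k * k = k + l * n.-1 -> k ^ 2 * b <= (n - a) * (k + l * b.-1) ->
  n < a + b + k -> (a + b + k == n.+1) && ((a == 1) || (b == 1)).
Proof.
move=> a0 b0 ka kb k1 knl cs nabk.
have l0 : 0 < l.
  case: (posnP l) knl => // -> ; rewrite mul0n addn0; clear -k1; nia.
have kn : k <= n.-1 by lia.
have lk : l < k.
  rewrite ltnNge; apply/negP => kl; have := leq_mul kl kn; clear -knl k1; lia.
have [d kE] : exists d, k = l + d.+1 by exists (k - l).-1; lia.
have lnk : l * (n - k) = k.-1 * d.+1.
  have -> : n - k = n.-1 - k.-1 by lia.
  by rewrite mulnBr; clear -knl kE k1; nia.
have [s nE] : exists s, n + s = a + b + k by exists (a + b + k - n); lia.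
have haemers : l * (a * b) + d.+1 * (a + b) <= d.+1 * n.
  have [c cE] : exists c, n = a + c by exists (n - a); lia.
  have [b' bE] : exists b', b = b'.+1 by exists b.-1; lia.
  have [n' n'E] : exists n', n = n'.+1 by exists n.-1; lia.
  have nac : n'.+1 = a + c by lia.
  move: cs knl; rewrite {1}cE addKn bE n'E /= -mulnn => cs knl.
  have e1 : l * n' * b + l * b = l * a * b + l * c * b.
     by rewrite -mulnDl -mulnSr nac mulnDr mulnDl.
  move: cs; rewrite knl nac kE; clear -e1 bE; subst b.
  rewrite !mulnS !mulnDl !mulnDr !mulnS; lia.
have {}haemers : l * (a * b) + d.+1 * s <= d.+1 * k.
  have := congr1 (muln d.+1) nE; rewrite !mulnDr; move: haemers; rewrite mulnDr; lia.
(* [r = n - k - b] and [t = n - k - a] are the slacks in the bounds on [b] and [a]. *)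
have [r aE] : exists r, a = s + r by exists (a - s); lia.
have [t bE] : exists t, b = s + t by exists (b - s); lia.
have s0 : 0 < s by lia.
have abp : s * (n - k) + r * t = a * b.
  have -> : n - k = s + r + t by lia.
  by rewrite aE bE !mulnDr !mulnDl; lia.
have : d.+1 * (s * k) <= d.+1 * k.
  apply: leq_trans haemers; rewrite -abp mulnDr (mulnCA l s) lnk.
  have [k' k'E] : exists k', k = k'.+1 by exists k.-1; lia.
  rewrite k'E /= mulnS mulnDr [_ * (s * k')]mulnC -mulnA; lia.
rewrite leq_pmul2l // -{2}[k]mul1n leq_pmul2r ?(ltnW k1) // => s1.
have {s0 s1} sE : s = 1 by lia.
apply/andP; split; first by lia.
(* At [s = 1] both sides agree up to the extra term [l * (r * t)], which must vanish; then [a] or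
   [b] equals [s]. *)
move: haemers; rewrite -abp sE mul1n mulnDr lnk.
have [k' k'E] : exists k', k = k'.+1 by exists k.-1; lia.
rewrite k'E /= => h.
have : r * t = 0 by clear -h l0; nia.
move/eqP; rewrite muln_eq0; lia.
Qed.

(** * Double counting and the bound for non-incident pairs *)

Section Graph.
Variables (V : finType) (e : rel V).
Hypothesis sym_e : symmetric e.

(** Both sides count the walks [x], [z], [y] with [y] in [B]. *)
Lemma sum_common_neighbours (B : {set V}) (x : V) :
  \sum_(y in B) #|common_neighbours e x y|
  = \sum_(z in neighbours e x) #|neighbours e z :&: B|.
Proof.
under eq_bigr do rewrite -sum1_card.
rewrite (exchange_big_dep (mem (neighbours e x))) /=; last first.
  by move=> y z _; rewrite inE => /andP[].
apply: eq_bigr => z xz; rewrite -sum1_card; apply: eq_bigl => y.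
by move: xz; rewrite !inE => ->; rewrite sym_e andbC.
Qed.

Lemma sum_degree_in (U B : {set V}) :
  (forall y, y \in B -> neighbours e y \subset U) ->
  \sum_(x in U) #|neighbours e x :&: B| = \sum_(y in B) #|neighbours e y|.
Proof.
move=> BU; under eq_bigr do rewrite -sum1_card.
rewrite (exchange_big_dep (mem B)) /=; last by move=> x y _ /setIP[].
apply: eq_bigr => y yB; rewrite -sum1_card; apply: eq_bigl => x.
rewrite !inE yB andbT sym_e; apply: andb_idl => yx.
by apply: (subsetP (BU y yB)); rewrite inE.
Qed.

(** Both sides count the walks [y], [x], [z] with ends in [B]; the hypothesis puts all their middles
    in [U]. *)
Lemma sum_degree_in_sqr (U B : {set V}) :
  (forall y, y \in B -> neighbours e y \subset U) ->
  \sum_(x in U) #|neighbours e x :&: B| ^ 2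
  = \sum_(y in B) \sum_(z in B) #|common_neighbours e y z|.
Proof.
move=> BU; under [RHS]eq_bigr do rewrite sum_common_neighbours.
rewrite (exchange_big_dep (mem U)) /=; last first.
  by move=> y x yB; apply: (subsetP (BU y yB)).
apply: eq_bigr => x xU; rewrite sum_nat_const -mulnn; congr (_ * _).
by apply: eq_card => y; rewrite [RHS]unfold_in !inE sym_e andbC.
Qed.

Variable k : nat.
Hypothesis reg_e : regular_graph e k.

Lemma sum_common_neighbours_design (l : nat) (B : {set V}) (y : V) :
  (forall z, z \in B -> y != z -> #|common_neighbours e y z| = l) ->
  y \in B -> \sum_(z in B) #|common_neighbours e y z| = k + l * #|B|.-1.
Proof.
move=> Bl yB; rewrite (bigD1 y) //= /common_neighbours setIid reg_e; congr (_ + _).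
rewrite (eq_bigr (fun=> l)); last by move=> z /andP[zB zy]; rewrite Bl // eq_sym.
rewrite sum_nat_cond_const mulnC; congr (_ * _).
by rewrite (cardsD1 y B) yB; apply: eq_card => z; rewrite !inE andbC.
Qed.

(** [P] and [Q] may coincide, which covers the case of one class. Every edge from [B] ends in
    [P :\: A], so Cauchy-Schwarz is applied to the degrees into [B] over that set. *)
Lemma nonincident_pair (l n : nat) (P Q A B : {set V}) :
  1 < k -> #|P| = n -> #|Q| = n ->
  (forall x, x \in P -> neighbours e x \subset Q) ->
  (forall y, y \in Q -> neighbours e y \subset P) ->
  (forall y z, y \in Q -> z \in Q -> y != z -> #|common_neighbours e y z| = l) ->
  A \subset P -> B \subset Q -> A != set0 -> B != set0 ->
  (forall x y, x \in A -> y \in B -> ~~ e x y) ->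
  n < #|A| + #|B| + k ->
  (#|A| + #|B| + k == n.+1) && ((#|A| == 1) || (#|B| == 1)).
Proof.
move=> k1 Pn Qn PQ QP Ql AP BQ A0 B0 AB.
have BU y : y \in B -> neighbours e y \subset P :\: A.
  move=> yB; apply/subsetP => x yx; rewrite inE (subsetP (QP _ (subsetP BQ _ yB))) //.
  by rewrite andbT; apply: contraL yx => /AB/(_ yB); rewrite inE sym_e.
have AU x : x \in A -> neighbours e x \subset Q :\: B.
  move=> xA; apply/subsetP => y xy; rewrite inE (subsetP (PQ _ (subsetP AP _ xA))) //.
  by rewrite andbT; apply: contraL xy => /(AB _ _ xA); rewrite inE.
have cPA : #|P :\: A| = n - #|A| by rewrite cardsD (setIidPr AP) Pn.
have cQB : #|Q :\: B| = n - #|B| by rewrite cardsD (setIidPr BQ) Qn.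
case/set0Pn: (A0) => x xA; case/set0Pn: (B0) => y yB.
have yQ := subsetP BQ _ yB.
have leAn := subset_leq_card AP; have leBn := subset_leq_card BQ.
have := subset_leq_card (BU y yB); have := subset_leq_card (AU x xA).
rewrite !reg_e cPA cQB => kB kA.
apply: (@haemers_arith n k l) => //; rewrite ?card_gt0 //; try lia.
  (* The identity [k * k = k + l * n.-1] counts the walks of length two from [y], all of which end
     in [Q]. *)
  rewrite -Qn -(sum_common_neighbours_design (y := y)) //; last first.
    by move=> z zQ; apply: Ql.
  rewrite sum_common_neighbours (eq_bigr (fun=> k)); last first.
    move=> z yz; rewrite (setIidPl _) ?reg_e // PQ //.
    exact: (subsetP (QP y yQ)).
  by rewrite sum_nat_const reg_e.
have B_gt0 : 0 < #|B| by rewrite card_gt0.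
(* The degrees into [B] sum to [#|B| * k] and their squares to [#|B| * (k + l * #|B|.-1)]; one
   factor [#|B|] then cancels. *)
have := sum_sqr_le (P :\: A) (fun x => #|neighbours e x :&: B|).
rewrite (sum_degree_in BU) (sum_degree_in_sqr BU) cPA.
rewrite (eq_bigr (fun=> k)); last by move=> *; apply: reg_e.
rewrite sum_nat_const (eq_bigr (fun=> k + l * #|B|.-1)); last first.
  move=> z zB; apply: sum_common_neighbours_design => // w wB.
  by apply: Ql; apply: (subsetP BQ).
rewrite sum_nat_const expnMn -mulnn (mulnCA (n - _)) -mulnA leq_pmul2l //.
by rewrite mulnC.
Qed.

(** * Cuts in the cases of one and of two classes *)

Lemma disconnectsP (S : {set V}) : disconnects e S ->
  exists A B : {set V}, [/\ A != set0, B != set0,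
    [disjoint A & B], ~: S = A :|: B &
    forall x y, x \in A -> y \in B -> ~~ e x y].
Proof.
case/existsP=> x /existsP[y /and3P[xS yS nxy]].
(* [A] is the component of [x] once [S] is deleted; the other part collects all remaining
   components. *)
pose A := [set z in ~: S | connect (delete_vertices e S) x z].
exists A, (~: S :\: A); split.
- by apply/set0Pn; exists x; rewrite !inE xS connect0.
- by apply/set0Pn; exists y; rewrite !inE yS nxy.
- by rewrite disjoint_sym disjoints_subset setDE subsetIr.
- rewrite -{1}(setID (~: S) A); congr (_ :|: _); apply/setIidPr.
  by apply/subsetP => z; rewrite inE => /andP[].
move=> z w; rewrite !inE => /andP[zS xz] /andP[nw wS].
apply: contra nw => zw; rewrite wS /=.
by apply: connect_trans xz (connect1 _); rewrite /delete_vertices /= zS wS.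
Qed.

Lemma disconnects_one_class (l : nat) (S : {set V}) :
  irreflexive e -> 1 < k ->
  (forall y z, y != z -> #|common_neighbours e y z| = l) ->
  disconnects e S -> k <= #|S|.
Proof.
move=> irr_e k1 el /disconnectsP[A [B [A0 B0 dAB SAB AB]]].
have cS : #|A| + #|B| + #|S| = #|V|.
  by rewrite -(cardsC S) SAB addnC cardsU disjoint_setI0 // cards0 subn0.
(* A vertex of [C] and its [k] neighbours all lie in [C :|: S]. *)
have nbhd_lt (C D : {set V}) : C :|: D = ~: S -> C != set0 ->
    (forall x y, x \in C -> y \in D -> ~~ e x y) -> k < #|C| + #|S|.
  move=> CD /set0Pn[x xC] nCD.
  have : x |: neighbours e x \subset C :|: S.
    rewrite subUset sub1set inE xC; apply/subsetP => y xy.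
    move/setP/(_ y): CD; rewrite !inE; case: (y \in C) => //=.
    case yD: (y \in D); last by move/esym/negbFE.
    by move: xy; rewrite inE (negPf (nCD x y xC yD)).
  move/subset_leq_card; rewrite cardsU1 reg_e inE irr_e => /leq_trans; apply.
  by rewrite cardsU leq_subr.
have kA : k < #|A| + #|S| by apply: (nbhd_lt A B).
have kB : k < #|B| + #|S|.
  apply: (nbhd_lt B A) => // [|x y xB yA]; first by rewrite setUC SAB.
  by rewrite sym_e AB.
rewrite leqNgt; apply/negP => Sk.
(* Since [#|S| < k], [kA] and [kB] give each part at least two vertices, against the singleton
   obtained here. *)
have /andP[/eqP abk ab1] : (#|A| + #|B| + k == #|V|.+1) && ((#|A| == 1) || (#|B| == 1)).
  apply: (@nonincident_pair l _ setT setT); rewrite ?cardsT ?subsetT //; try lia.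
  by move=> y z _ _; apply: el.
lia.
Qed.

Lemma disconnects_two_classes (l n : nat) (P Q S : {set V}) :
  1 < k -> #|P| = n -> #|Q| = n -> [disjoint P & Q] -> P :|: Q = setT ->
  (forall x, x \in P -> neighbours e x \subset Q) ->
  (forall y, y \in Q -> neighbours e y \subset P) ->
  (forall x z, x \in P -> z \in P -> x != z -> #|common_neighbours e x z| = l) ->
  (forall y z, y \in Q -> z \in Q -> y != z -> #|common_neighbours e y z| = l) ->
  disconnects e S -> k <= #|S|.
Proof.
move=> k1 Pn Qn dPQ PQT PQ QP Pl Ql /disconnectsP[A [B [A0 B0 dAB SAB AB]]].
have BA x y : x \in B -> y \in A -> ~~ e x y.
  by move=> xB yA; rewrite sym_e AB.
have splitT (X : {set V}) : #|X| = #|X :&: P| + #|X :&: Q|.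
  rewrite -[X in LHS]setIT -PQT setIUr cardsU setIACA (disjoint_setI0 dPQ).
  by rewrite setI0 cards0 subn0.
have splitS (X : {set V}) : #|X| = #|X :&: A| + #|X :&: B| + #|X :&: S|.
  rewrite -(cardsID S X) setDE SAB setIUr cardsU setIACA (disjoint_setI0 dAB).
  by rewrite setI0 cards0 subn0 addnC.
(* If [C] misses [Q'], the neighbours of a vertex of [C] lie in [Q'], hence outside both [C] and
   [D], hence in [S]. *)
have empty_side (C D P' Q' : {set V}) :
    C :|: D = ~: S -> C != set0 -> P' :|: Q' = setT ->
    (forall x y, x \in C -> y \in D -> ~~ e x y) ->
    (forall x, x \in P' -> neighbours e x \subset Q') ->
    C :&: Q' = set0 -> k <= #|S|.
  move=> CD /set0Pn[x xC] PQ' nCD sub CQ.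
  have xP : x \in P'.
    move/setP/(_ x): PQ'; move/setP/(_ x): CQ.
    by rewrite !inE xC /= => ->; rewrite orbF.
  rewrite -(reg_e x); apply/subset_leq_card/subsetP => y xy.
  have yQ := subsetP (sub x xP) y xy.
  move/setP/(_ y): CD; move/setP/(_ y): CQ; rewrite !inE yQ andbT => -> /=.
  case yD: (y \in D); last by move/esym/negbFE.
  by move: xy; rewrite inE (negPf (nCD x y xC yD)).
have QPT : Q :|: P = setT by rewrite setUC.
have SBA : B :|: A = ~: S by rewrite setUC.
have [AP0|AP0] := eqVneq (A :&: P) set0; first exact: (empty_side A B Q P).
have [AQ0|AQ0] := eqVneq (A :&: Q) set0; first exact: (empty_side A B P Q).
have [BP0|BP0] := eqVneq (B :&: P) set0; first exact: (empty_side B A Q P).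
have [BQ0|BQ0] := eqVneq (B :&: Q) set0; first exact: (empty_side B A P Q).
have bound1 : n < #|A :&: P| + #|B :&: Q| + k -> #|A :&: P| + #|B :&: Q| + k = n.+1.
  move=> lt; have [] // := andP (nonincident_pair k1 Pn Qn PQ QP Ql _ _ AP0 BQ0 _ lt).
  - exact: subsetIr.
  - exact: subsetIr.
  - by move=> x y /setIP[xA _] /setIP[yB _]; apply: AB.
  - by move/eqP.
have bound2 : n < #|A :&: Q| + #|B :&: P| + k -> #|A :&: Q| + #|B :&: P| + k = n.+1.
  move=> lt; have [] // := andP (nonincident_pair k1 Qn Pn QP PQ Pl _ _ AQ0 BP0 _ lt).
  - exact: subsetIr.
  - exact: subsetIr.
  - by move=> x y /setIP[xA _] /setIP[yB _]; apply: AB.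
  - by move/eqP.
(* Each of the two non-incident pairs has at most [n.+1 - k] vertices out of [2 * n] in total, so
   [#|S| >= 2 * k.-1], which is at least [k] as [1 < k]. *)
move: (splitS P) (splitS Q) (splitT S) bound1 bound2.
rewrite Pn Qn ![P :&: _]setIC ![Q :&: _]setIC; lia.
Qed.

(** * Structure of the classes when [l2] is zero *)

Lemma disconnects_ddg (v l1 m n : nat) (S : {set V}) :
  irreflexive e -> connected_graph e ->
  divisible_design_graph e v k l1 0 m n -> 1 < k ->
  disconnects e S -> k <= #|S|.
Proof.
move=> irr_e [V0 conn_e] [_ _ _ [X [partX _ Xn Xl1 Xl2]]] k1 dS.
have tX : trivIset X by case/and3P: partX.
have covX x : x \in cover X by rewrite (cover_partition partX) inE.
pose c := pblock X.
have cX x : c x \in X by apply: pblock_mem.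
have cx x : x \in c x by rewrite mem_pblock.
have cE x y : (y \in c x) = (c x == c y) by rewrite eq_pblock.
have nbr_class x y z : e x y -> e x z -> c y = c z.
  move=> xy xz; apply/eqP/negPn/negP => yz.
  have /eqP := Xl2 _ _ y z (cX y) (cX z) yz (cx y) (cx z).
  rewrite cards_eq0 => /eqP/setP/(_ x).
  by rewrite !inE ![e _ x]sym_e xy xz.
have l1_gt0 : 0 < l1.
  case/card_gt0P: V0 => x _.
  have /card_gt1P[y [z]] : 1 < #|neighbours e x| by rewrite reg_e.
  rewrite !inE => -[xy xz yz].
  rewrite -(Xl1 (c y) y z) // ?cE ?(nbr_class x y z) //.
  by apply/card_gt0P; exists x; rewrite !inE ![e _ x]sym_e xy.
(* As [l1] is positive, distinct [u] and [x] in one class share a neighbour [y], whose class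
   contains the neighbours of both. *)
have class_nbrs u w : e u w -> forall x, x \in c u -> neighbours e x \subset c w.
  move=> uw x xu; apply/subsetP => z; rewrite inE => xz; rewrite cE; apply/eqP.
  have [xu'|neq_ux] := eqVneq u x; first by apply: (nbr_class x) => //; rewrite -xu'.
  move: l1_gt0; rewrite -(Xl1 (c u) u x) // => /card_gt0P[y].
  rewrite !inE => /andP[uy xy].
  by rewrite (nbr_class u w y) // (nbr_class x y z).
case/card_gt0P: V0 => x0 _.
have /card_gt0P[y0] : 0 < #|neighbours e x0| by rewrite reg_e ltnW.
rewrite inE => xy0.
have yx0 : e y0 x0 by rewrite sym_e.
have PQ := class_nbrs _ _ xy0; have QP := class_nbrs _ _ yx0.
(* The union of the two classes is closed under adjacency, so connectedness makes it everything. *)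
have PQT : c x0 :|: c y0 = setT.
  apply/setP => z; rewrite [RHS]inE.
  rewrite -(closed_connect _ (conn_e x0 z)) ?inE ?cx //.
  apply: (intro_closed (sym_connect_sym sym_e)) => x y xy.
  rewrite !inE => /orP[/PQ|/QP] /subsetP/(_ y); rewrite inE => -> //.
  by rewrite orbT.
have [eqPQ|neqPQ] := eqVneq (c x0) (c y0).
  apply: (@disconnects_one_class l1) => // y z; apply: (Xl1 (c x0)) => //.
    by rewrite -[c x0]setUid {2}eqPQ PQT.
  by rewrite -[c x0]setUid {2}eqPQ PQT.
apply: (@disconnects_two_classes l1 n (c x0) (c y0)) => //; try exact: Xn.
- rewrite -setI_eq0; apply/eqP/setP => z; rewrite !inE !cE.
  by apply: contraNF neqPQ => /andP[/eqP-> /eqP->].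
- by move=> x z; apply: Xl1.
- by move=> x z; apply: Xl1.
Qed.

End Graph.

(** * Comparison of the minimum over all cuts with [k] *)

Theorem proposition5 (V : finType) (e : rel V) (v k l1 l2 m n : nat)
  (simple_e : simple_graph e) (conn_e : connected_graph e)
  (ddg_e : divisible_design_graph e v k l1 l2 m n) (l2_eq0 : l2 = 0%N) :
  vertex_connectivity e = k.
Proof.
case: simple_e => sym_e irr_e; rewrite l2_eq0 in ddg_e.
have [_ _ reg_e _] := ddg_e; have [V0 conn] := conn_e.
rewrite /vertex_connectivity; case: ifPn => [/forallP complete_e|].
  case/card_gt0P: V0 => x _; rewrite -(reg_e x) -(cardsC1 x).
  apply: eq_card => y; rewrite !inE.
  have [->|neq_yx] := eqVneq y x; first by rewrite irr_e.
  by have /forallP/(_ y)/implyP-> := complete_e x; rewrite // eq_sym.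
case/forallPn=> x /forallPn[y]; rewrite negb_imply => /andP[neq_xy nxy].
(* A path from [x] to [y] would have to start with a step into the deleted neighbourhood. *)
have dN : disconnects e (neighbours e x).
  apply/existsP; exists x; apply/existsP; exists y.
  rewrite !inE irr_e (negPf nxy) /=; apply/negP => /connectP[[|z p] /= xp yE].
    by rewrite yE eqxx in neq_xy.
  by move: xp; rewrite /delete_vertices /= !inE; case: (e x z); rewrite ?andbF.
apply/eqP; rewrite eqn_leq; apply/andP; split.
  rewrite -(reg_e x) -minEnat.
  exact: (bigmin_le_cond _ (fun S : {set V} => #|S|) dN).
apply: (big_ind (leq k)) => [|a b ka kb|S dS].
- by rewrite -(reg_e x) max_card.
- by rewrite leq_min ka kb.
have [k1|k1] := ltnP 1 k.
  exact: (disconnects_ddg sym_e reg_e irr_e conn_e ddg_e k1 dS).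
(* For [k <= 1] it is enough that [S] is nonempty: deleting nothing leaves the graph connected. *)
apply: leq_trans k1 _; rewrite card_gt0; apply: contraTneq dS => ->.
apply/existsPn => u; apply/existsPn => w; rewrite !inE /= negbK.
rewrite (eq_connect (e' := e)) ?conn // => a b.
by rewrite /delete_vertices /= !inE.
Qed.
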